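(* Let $t$ be an $\mathrm{SL}_2$-tiling with infinitely many entries equal to $1$ in each of the first and third quadrants. Consider $D_2$, the disc with two accumulation points and intervals denoted $\mathrm{I}$ and $\mathrm{III}$. Then $\mathfrak{T}=\Theta(t)$ is a good triangulation of $D_2$ which satisfies $\Phi(\mathfrak{T})=t$, that is, $t(b,v)=\mathfrak{T}(b^{\mathrm{I}},v^{\mathrm{III}})$ for all $b,v\in\mathbb{Z}$.
   Context: An $\mathrm{SL}_2$-tiling is a map $t:\mathbb{Z}\times\mathbb{Z}\to\{1,2,3,\ldots\}$ with $t(i,j)t(i+1,j+1)-t(i,j+1)t(i+1,j)=1$ for all $i,j$. Entries $t(i,j)$ are written in matrix style ($i$ increases downwards, $j$ increases to the right), so the first quadrant is $\{(i,j)\mid i<0,\ j>0\}$ and the third quadrant is $\{(i,j)\mid i>0,\ j<0\}$. Associated infinite friezes: for $a\leqslant d$ and $u\leqslant x$, $p(a,d)=t(a,w)t(d,w+1)-t(a,w+1)t(d,w)$ and $q(u,x)=t(c,u)t(c+1,x)-t(c,x)t(c+1,u)$; these do not depend on the integers $w$, $c$, and are positive for $a<d$, $u<x$. The disc $D_2$. Let $C$ be a circle with anticlockwise orientation, bounding a disc. For points on $C$, $\mu_1<\cdots<\mu_m$ means that each $\mu_i$ differs from its predecessor and that, starting at $\mu_1$ and moving anticlockwise by one full turn, one meets the points in precisely the order $\mu_1,\ldots,\mu_m$ (similarly for infinite strings). $D_2$ is the disc with two distinct accumulation points $\xi_{\mathrm{I}},\xi_{\mathrm{III}}\in C$ and vertices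 $m^{\mathrm{I}},m^{\mathrm{III}}\in C$, $m\in\mathbb{Z}$, with $\xi_{\mathrm{III}}<\cdots<(-1)^{\mathrm{I}}<0^{\mathrm{I}}<1^{\mathrm{I}}<\cdots<\xi_{\mathrm{I}}$ and $\xi_{\mathrm{I}}<\cdots<(-1)^{\mathrm{III}}<0^{\mathrm{III}}<1^{\mathrm{III}}<\cdots<\xi_{\mathrm{III}}$; $m^{J}\to\xi_J$ for $m\to\infty$, and for $m\to-\infty$ $m^{J}$ converges to the other accumulation point. Interval $\mathrm{I}$ (resp. $\mathrm{III}$) is the open part of $C$ going anticlockwise from $\xi_{\mathrm{III}}$ to $\xi_{\mathrm{I}}$ (resp. from $\xi_{\mathrm{I}}$ to $\xi_{\mathrm{III}}$). Arcs and triangulations. The neighbours of $m^{J}$ are $(m\pm1)^{J}$. For distinct vertices $\mu,\nu$, $\{\mu,\nu\}$ is an edge if $\mu,\nu$ are neighbours and an arc otherwise. Arcs $\{\mu,\nu\}$, $\{\pi,\rho\}$ cross if $\mu<\pi<\nu<\rho$ or $\pi<\mu<\rho<\nu$. A partial triangulation is a set of pairwise non-crossing arcs; a triangulation is a maximal such set. A set of arcs blocks the accumulation point $\xi$, which separates an interval $J$ from the next interval $K$ anticlockwise, if it contains arcs $\{\iota_i,\kappa_i\}$, $i\geqslant1$, with vertices $\iota_i\in J$, $\kappa_i\in K$ and $\iota_1<\iota_2<\cdots<\xi<\cdots<\kappa_2<\kappa_1$. A triangulation is good if it blocks every accumulation point. $\Theta(t)$ is the set of arcs $\{\{b^{\mathrm{I}},v^{\mathrm{III}}\}\mid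 t(b,v)=1\}\cup\{\{a^{\mathrm{I}},d^{\mathrm{I}}\}\mid a+2\leqslant d,\ p(a,d)=1\}\cup\{\{u^{\mathrm{III}},x^{\mathrm{III}}\}\mid u+2\leqslant x,\ q(u,x)=1\}$. Conway--Coxeter counting. Let $\mathfrak{S}$ be a triangulation of a finite polygon $P$ and $\mu$ a vertex of $P$. Assign $0$ to $\mu$; assign $1$ to each vertex joined to $\mu$ by an edge of $P$ or an arc in $\mathfrak{S}$; iteratively, if exactly two vertices of a triangle of $\mathfrak{S}$ have been assigned integers, say $i$ and $j$, assign $i+j$ to its third vertex. $\mathfrak{S}(\mu,\nu)$ is the integer assigned to $\nu$. If $\mathfrak{T}$ is a good triangulation of $D_2$ and $\mu,\nu$ are vertices, choose a finite set $M=\{\mu_1<\cdots<\mu_m\}$ ($m\geqslant2$) of vertices containing $\mu,\nu$ such that each of $\{\mu_1,\mu_2\},\ldots,\{\mu_m,\mu_1\}$ is an edge or an arc in $\mathfrak{T}$ (such $M$ exists); $M$ spans a finite polygon $P$ with these pairs as edges, the remaining arcs of $\mathfrak{T}$ between elements of $M$ form a triangulation $\mathfrak{T}_P$ of $P$, and $\mathfrak{T}(\mu,\nu):=\mathfrak{T}_P(\mu,\nu)$, independently of $M$. $\Phi(\mathfrak{T})$ denotes the $\mathrm{SL}_2$-tiling $(b,v)\mapsto\mathfrak{T}(b^{\mathrm{I}},v^{\mathrm{III}})$. *)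

(* Defs.v *)
From HB Require Import structures.
From mathcomp Require Import all_boot all_order all_algebra.
From mathcomp Require Import boolp classical_sets functions cardinality.

Set Implicit Arguments.
Unset Strict Implicit.
Unset Printing Implicit Defensive.

Import Order.TTheory GRing.Theory Num.Theory.

Local Open Scope classical_set_scope.
Local Open Scope ring_scope.

Definition SL2_tiling (t : int -> int -> int) : Prop :=
  (forall i j, 0 < t i j) /\
  (forall i j, t i j * t (i + 1) (j + 1) - t i (j + 1) * t (i + 1) j = 1).

Definition ones_first_quadrant (t : int -> int -> int) : set (int * int) :=
  [set ij | [/\ ij.1 < 0, 0 < ij.2 & t ij.1 ij.2 = 1]].

Definition ones_third_quadrant (t : int -> int -> int) : set (int * int) :=
  [set ij | [/\ 0 < ij.1, ij.2 < 0 & t ij.1 ij.2 = 1]].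

(* For an SL2-tiling the defining 2x2 minors do not depend on the auxiliary
   column w (for p) or row c (for q); both are taken to be 0. *)
Definition frieze_p (t : int -> int -> int) (a d : int) : int :=
  t a 0 * t d 1 - t a 1 * t d 0.

Definition frieze_q (t : int -> int -> int) (u x : int) : int :=
  t 0 u * t 1 x - t 0 x * t 1 u.

Inductive D2_interval := I1 | I3.

Definition D2_interval_eqb (J K : D2_interval) : bool :=
  match J, K with I1, I1 | I3, I3 => true | _, _ => false end.

Lemma D2_interval_eqP : Equality.axiom D2_interval_eqb.
Proof. by case; case; constructor. Qed.

HB.instance Definition _ := hasDecEq.Build D2_interval D2_interval_eqP.

(* The next interval anticlockwise. *)
Definition next_interval (J : D2_interval) : D2_interval :=
  match J with I1 => I3 | I3 => I1 end.

(* (J, m) is the vertex m^J. *)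
Definition vertex : Type := (D2_interval * int)%type.

(* The points of the circle that matter: Acc J is the accumulation point xi_J,
   which separates J from the next interval anticlockwise. *)
Inductive D2_point := Acc of D2_interval | Vtx of vertex.

(* Going anticlockwise from xi_III, one meets xi_III, interval I, xi_I and
   interval III, in this order; each interval is ordered like the integers. *)
Definition sector (p : D2_point) : nat :=
  match p with
  | Acc I3 => 0%N
  | Vtx (I1, _) => 1%N
  | Acc I1 => 2%N
  | Vtx (I3, _) => 3%N
  end.

Definition coordinate (p : D2_point) : int :=
  match p with Acc _ => 0 | Vtx (_, m) => m end.

Definition point_lt (p r : D2_point) : bool :=
  (sector p < sector r)%N ||
  ((sector p == sector r) && (coordinate p < coordinate r)).

(* The anticlockwise string s_1 < ... < s_m: cutting the circle at xi_III,
   some rotation of the string is strictly increasing.  In particular the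
   points of the string are pairwise distinct. *)
Definition cyclic_lt (s : seq D2_point) : Prop :=
  exists n : nat, sorted point_lt (rot n s).

Definition neighbours (mu nu : vertex) : Prop :=
  mu.1 = nu.1 /\ (nu.2 = mu.2 + 1 \/ mu.2 = nu.2 + 1).

(* Edges and arcs are two-element sets of vertices. *)
Definition is_edge (e : set vertex) : Prop :=
  exists mu nu : vertex, [/\ mu <> nu, neighbours mu nu & e = [set mu; nu]].

Definition is_arc (e : set vertex) : Prop :=
  exists mu nu : vertex, [/\ mu <> nu, ~ neighbours mu nu & e = [set mu; nu]].

Definition cross (e f : set vertex) : Prop :=
  exists mu nu pi rho : vertex,
    [/\ e = [set mu; nu], f = [set pi; rho] &
        cyclic_lt [:: Vtx mu; Vtx pi; Vtx nu; Vtx rho] \/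
        cyclic_lt [:: Vtx pi; Vtx mu; Vtx rho; Vtx nu]].

Definition partial_triangulation (T : set (set vertex)) : Prop :=
  (forall e, T e -> is_arc e) /\ (forall e f, T e -> T f -> ~ cross e f).

Definition triangulation (T : set (set vertex)) : Prop :=
  partial_triangulation T /\
  (forall T' : set (set vertex),
     partial_triangulation T' -> T `<=` T' -> T' = T).

(* The infinite string iota_1 < iota_2 < ... < xi < ... < kappa_2 < kappa_1 is
   expressed through its finite truncations. *)
Definition blocks (T : set (set vertex)) (J : D2_interval) : Prop :=
  exists iota kappa : nat -> vertex,
    [/\ forall i, (iota i).1 = J /\ (kappa i).1 = next_interval J,
        forall i, T [set iota i; kappa i] &
        forall n, cyclic_lt (mkseq (fun i => Vtx (iota i)) n ++
                             Acc J :: rev (mkseq (fun i => Vtx (kappa i)) n))].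

Definition good_triangulation (T : set (set vertex)) : Prop :=
  triangulation T /\ (forall J, blocks T J).

Definition Theta (t : int -> int -> int) : set (set vertex) :=
  [set e | exists b v : int, t b v = 1 /\ e = [set (I1, b); (I3, v)]] `|`
  [set e | exists a d : int,
     [/\ a + 2 <= d, frieze_p t a d = 1 & e = [set (I1, a); (I1, d)]]] `|`
  [set e | exists u x : int,
     [/\ u + 2 <= x, frieze_q t u x = 1 & e = [set (I3, u); (I3, x)]]].

(* A finite polygon P is the list M of its vertices in anticlockwise order. *)
Definition polygon_edges (M : seq vertex) : set (set vertex) :=
  [set e | exists2 mu, mu \in M & e = [set mu; next M mu]].

Definition joined (M : seq vertex) (S : set (set vertex)) (x y : vertex) : Prop :=
  (polygon_edges M `|` S) [set x; y].

Definition triangle (M : seq vertex) (S : set (set vertex)) (x y z : vertex)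
    : Prop :=
  [/\ joined M S x y, joined M S y z & joined M S x z].

(* CC_stage M S mu A: the graph A of a partial assignment of integers to the
   vertices of P arises at some stage of Conway-Coxeter counting from mu. *)
Inductive CC_stage (M : seq vertex) (S : set (set vertex)) (mu : vertex)
    : (vertex -> int -> Prop) -> Prop :=
| CC_start :
    CC_stage M S mu
      (fun x n => (x = mu /\ n = 0) \/ (joined M S mu x /\ n = 1))
| CC_step (A : vertex -> int -> Prop) (x y z : vertex) (i j : int) :
    CC_stage M S mu A ->
    triangle M S x y z -> A x i -> A y j -> (forall k, ~ A z k) ->
    CC_stage M S mu (fun w n => A w n \/ (w = z /\ n = i + j)).

(* S(mu, nu) = n: counting can reach nu, and whatever the order of the steps
   the integer assigned to nu is n. *)
Definition polygon_count (M : seq vertex) (S : set (set vertex))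
    (mu nu : vertex) (n : int) : Prop :=
  (exists A, CC_stage M S mu A /\ A nu n) /\
  (forall A k, CC_stage M S mu A -> A nu k -> k = n).

Definition spans_polygon (T : set (set vertex)) (M : seq vertex) : Prop :=
  [/\ (2 <= size M)%N,
      cyclic_lt (map Vtx M) &
      forall e, polygon_edges M e -> is_edge e \/ T e].

(* T_P: the arcs of T between elements of M, other than the edges of P. *)
Definition restricted_triangulation (T : set (set vertex)) (M : seq vertex)
    : set (set vertex) :=
  [set e | T e /\ e `<=` [set x | x \in M]] `\` polygon_edges M.

(* T(mu, nu) = n: a suitable M exists, and every suitable M gives n. *)
Definition D2_count (T : set (set vertex)) (mu nu : vertex) (n : int) : Prop :=
  (exists M, [/\ spans_polygon T M, mu \in M & nu \in M]) /\
  (forall M, spans_polygon T M -> mu \in M -> nu \in M ->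
     polygon_count M (restricted_triangulation T M) mu nu n).

(* Phi(T) = t. *)
Definition is_Phi (T : set (set vertex)) (t : int -> int -> int) : Prop :=
  forall b v : int, D2_count T (I1, b) (I3, v) (t b v).

(* Main.v *)
Require Import Defs.
From mathcomp Require Import all_boot all_order all_algebra.
From mathcomp Require Import boolp classical_sets functions cardinality.
From mathcomp Require Import zify ring.

(** Every SL2-tiling comes from vectors in the integer plane.  Each vertex x of
    the disc gets a vector V x such that det (V x) (V y) is positive whenever x
    precedes y on the circle cut open at the accumulation point between III and
    I, and this determinant is t, p or q according to the intervals of x and y
    (tiling_row, tiling_vector_gt0).  Put lambda x y = |det (V x) (V y)|.
    Neighbours have lambda = 1, so Theta t consists of all non-neighbouring
    pairs with lambda = 1 (Theta_unit_arcs), and everything to be proved is a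
    statement about the vectors.

    The tool is the Pluecker relation between four vectors, which here reads as
    Ptolemy's relation
      lambda(a,c) lambda(b,d) = lambda(a,b) lambda(c,d) + lambda(a,d) lambda(b,c)
    for a < b < c < d on the circle.  Its right hand side is at least 2, so two
    pairs with lambda = 1 never cross.  The circle can be read
    from any vertex mu: negating the vectors of the vertices that precede mu
    keeps all determinants positive (cut_vector_gt0).  The combinatorial
    arguments therefore concern a linear order with least element mu.

    Consider a finite polygon all of whose edges have lambda = 1.  It has an ear
    away from mu, a vertex b whose two neighbours a, c in the polygon satisfy
    lambda(a,c) = 1 (exists_ear): otherwise lambda(mu, -) would be convex, hence
    strictly increasing around the polygon, and could not return to the value 1
    at the last vertex.  Cutting off ears one after another shows
    - that a pair {mu, nu} in the polygon with lambda(mu,nu) > 1 is crossed by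
      some pair with lambda = 1 (unit_or_crossed), whence Theta t is maximal;
    - that Conway-Coxeter counting from mu reaches every vertex of the polygon
      (count_reaches).
    By Ptolemy's relation every counting step preserves the rule that x carries
    the number lambda(mu,x), provided that the newly assigned vertex lies beyond
    the edge between the two old ones.  It does, because a vertex can be
    assigned only after the endpoints of every unit pair that separates it from
    mu (count_sound).  For mu in I and nu in III this number is t.

    The quadrant hypotheses provide the blocking and the polygons.  For a fixed
    b the entries t(b-1,v), taken at those v for which t(b,v) = 1, are positive
    and strictly decreasing in v, so the ones of a row do not extend infinitely
    far to the right; by symmetry the same holds in the other directions, and
    infinitely many ones in a quadrant must go to infinity in both coordinates.
    Two such ones, one in each quadrant, close up long runs of consecutive
    vertices of I and III to a polygon containing any two given vertices. *)

Set Implicit Arguments.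
Unset Strict Implicit.
Unset Printing Implicit Defensive.

Import Order.TTheory GRing.Theory Num.Theory.

Local Open Scope classical_set_scope.
Local Open Scope ring_scope.

(** * Ears of unit polygons *)

Definition det (v w : int * int) : int := v.1 * w.2 - v.2 * w.1.

Lemma detC v w : det w v = - det v w.
Proof. by rewrite /det; ring. Qed.

Lemma detvv v : det v v = 0.
Proof. by rewrite /det; ring. Qed.

(** The Pluecker relation: the 2x2 minors of a 2x4 matrix. *)
Lemma ptolemy a b c d :
  det a c * det b d = det a b * det c d + det a d * det b c.
Proof. by rewrite /det; ring. Qed.

Section Configuration.

Variables (T : eqType) (lt : rel T) (W : T -> int * int).

Local Notation D x y := (det (W x) (W y)).

Hypothesis lt_trans : transitive lt.
Hypothesis D_gt0 : forall x y, lt x y -> 0 < D x y.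

Lemma ones_noncrossing a b c d :
  lt a b -> lt b c -> lt c d -> D a c = 1 -> D b d = 1 -> False.
Proof.
move=> ab bc cd ac bd.
have := ptolemy (W a) (W b) (W c) (W d); rewrite ac bd => E.
have ad := lt_trans (lt_trans ab bc) cd.
by have := D_gt0 ab; have := D_gt0 bc; have := D_gt0 cd; have := D_gt0 ad; nia.
Qed.

Definition unit_step x y := lt x y && (D x y == 1).

(** The closing edge enters as D x (last x s), not D (last x s) x, because x is
    the least vertex. *)
Definition unit_polygon x s := path unit_step x s && (D x (last x s) == 1).

(** Convexity: if D a b = D b c = 1, then D x a + D x c = D a c * D x b by
    Ptolemy's relation, so D x keeps growing as long as no D a c equals 1.
    The base point x stays fixed while the induction shortens the path from the
    left. *)
Lemma no_ear_growth x a b s :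
  path unit_step a (b :: s) -> 0 <= D x a -> D x a < D x b ->
  (exists s1 a' b' c' s2,
      [:: a, b & s] = s1 ++ [:: a', b', c' & s2] /\ D a' c' = 1) \/
  D x b <= D x (last b s) /\ (s <> [::] -> D x b < D x (last b s)).
Proof.
elim: s a b => [|c s IH] a b; first by right; split.
move=> /= /andP[/andP[ab /eqP Dab] pth] a0 ab_lt.
have /andP[/andP[bc /eqP Dbc] _] := pth.
case: (eqVneq (D a c) 1) => [ac1|acN1].
  by left; exists [::], a, b, c, s.
have ac2 : 2 <= D a c.
  by have := D_gt0 (lt_trans ab bc); move/eqP: acN1; lia.
have E : D x b * D a c = D x a + D x c.
  by have := ptolemy (W x) (W a) (W b) (W c); rewrite Dab Dbc !mulr1.
have bc_lt : D x b < D x c by nia.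
have [| | |[s1 [a' [b' [c' [s2 [-> Dac]]]]]]|[le_last _]] := IH b c.
- exact: pth.
- by lia.
- exact: bc_lt.
- by left; exists (a :: s1), a', b', c', s2.
by right => /=; split=> [|_]; lia.
Qed.

(** D x starts with the value 1 and has the value 1 at the last vertex, so it
    cannot grow all the time.  The ear b is neither x nor the last vertex, hence
    the polygon that remains still has x as its first vertex. *)
Lemma exists_ear x s :
  unit_polygon x s -> (1 < size s)%N ->
  exists s1 b c s2, [/\ s = s1 ++ [:: b, c & s2],
    unit_polygon x (s1 ++ c :: s2), unit_step (last x s1) b, unit_step b c
    & D (last x s1) c = 1].
Proof.
move=> /andP[pth Dlast] s_gt1; case: s pth Dlast s_gt1 => [|b0 [|c0 s]] // pth Dlast _.
have Dxb : D x b0 = 1 by case/andP: (pth) => /andP[_ /eqP].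
have [| |[s1 [a [b [c [s2 [E Dac]]]]]]|[_]] := @no_ear_growth x x b0 (c0 :: s) pth.
- by rewrite detvv.
- by rewrite detvv Dxb.
- have /= [s0 Es0 E0] : exists2 s0, [:: b0, c0 & s] = s0 ++ [:: b, c & s2]
      & last x s0 = a.
    case: s1 E => [[<- <- <- <-]|x' s1 [_ ->]]; first by exists [::].
    by exists (rcons s1 a); rewrite ?last_rcons // cat_rcons.
  move: pth Dlast.
  rewrite Es0 cat_path last_cat /= E0 => /and4P[p0 ab bc p2] Dl.
  exists s0, b, c, s2; rewrite E0; split=> //.
  rewrite /unit_polygon cat_path last_cat /= p0 E0 p2 Dl !andbT /=.
  rewrite /unit_step Dac eqxx andbT.
  by case/andP: ab => ab _; case/andP: bc => bc _; exact: lt_trans bc.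
have nil_neq : c0 :: s <> [::] by [].
by move=> /(_ nil_neq); rewrite -[last b0 _]/(last x [:: b0, c0 & s]) Dxb (eqP Dlast) ltxx.
Qed.

Lemma unit_polygon_lt x s y : unit_polygon x s -> y \in s -> lt x y.
Proof.
case/andP=> pth _ ys.
have : path lt x s by apply: sub_path pth => u v /andP[].
by move/(order_path_min lt_trans)/allP; exact.
Qed.

(** Cut off ears until y itself is the ear; then the edge that cuts off y either
    starts at x, and D x y = 1 as an edge, or separates y from x. *)
Lemma unit_or_crossed x s y :
  unit_polygon x s -> y \in s ->
  D x y = 1 \/ exists a c, [/\ lt x a, lt a y, lt y c & D a c = 1].
Proof.
have [n] := ubnP (size s); elim: n s => // n IH s le_n polys ys.
have [s_le1|s_gt1] := leqP (size s) 1.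
  case: s ys polys s_le1 {le_n} => [|z [|]] //; rewrite inE => /eqP-> /andP[_ /eqP].
  by left.
have [s1 [b [c [s2 [Es poly' /andP[ab /eqP Dab] /andP[bc _] Dac]]]]] :=
  exists_ear polys s_gt1.
have [ys'|yNs'] := boolP (y \in s1 ++ c :: s2).
  by apply: IH poly' ys'; move: le_n; rewrite Es !size_cat /=; lia.
have yb : y = b.
  by move: ys yNs'; rewrite Es !mem_cat !inE => /or3P[->|/eqP|->] //; rewrite orbT.
rewrite yb; case/lastP: s1 Es poly' ab Dab Dac {yNs'} => [|s1 a] Es poly' ab Dab Dac.
  by left.
move: ab Dab Dac; rewrite last_rcons => ab Dab Dac.
right; exists a, c; split=> //.
by apply: unit_polygon_lt polys _; rewrite Es mem_cat mem_rcons mem_head.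
Qed.

End Configuration.

(** * Conway-Coxeter counting in a unit polygon *)

Section Counting.

Variables (lt : rel vertex) (W : vertex -> int * int).
Local Notation D x y := (det (W x) (W y)).
Hypothesis lt_trans : transitive lt.
Hypothesis lt_total : forall x y, x <> y -> lt x y \/ lt y x.
Hypothesis D_gt0 : forall x y, lt x y -> 0 < D x y.

Variables (M : seq vertex) (S : set (set vertex)) (mu : vertex).
Hypothesis mu_min : forall x, x <> mu -> lt mu x.

(** Cutting off an ear b leaves a smaller polygon; once all its vertices have been
    assigned, one step through the triangle of the ear assigns b. *)
Lemma count_reaches s :
  (forall x y, x \in M -> y \in M -> `|D x y| = 1 -> joined M S x y) ->
  mu \in M -> {subset s <= M} -> unit_polygon lt W mu s ->
  exists A, CC_stage M S mu A /\ forall x, x \in mu :: s -> exists n, A x n.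
Proof.
move=> joinedI muM.
have [n] := ubnP (size s); elim: n s => // n IH s le_n sM polys.
have [s_le1|s_gt1] := leqP (size s) 1.
  exists (fun x n => (x = mu /\ n = 0) \/ (joined M S mu x /\ n = 1)).
  split=> [|x]; first exact: CC_start.
  rewrite inE => /orP[/eqP->|xs]; first by exists 0; left.
  exists 1; right; split=> //; apply: joinedI => //; first exact: sM.
  case: s xs polys s_le1 {le_n sM} => [|z [|]] //; rewrite inE => /eqP-> /andP[_ /eqP->].
  by rewrite normr1.
have [s1 [b [c [s2 [Es poly' /andP[ab /eqP Dab] /andP[bc /eqP Dbc] Dac]]]]] :=
  exists_ear lt_trans D_gt0 polys s_gt1.
have s'M : {subset s1 ++ c :: s2 <= M}.
  move=> x; rewrite mem_cat inE => xs; apply: sM.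
  by rewrite Es mem_cat !inE; case/or3P: xs => ->; rewrite ?orbT.
have [|A [stA asgA]] := IH _ _ s'M poly'.
  by move: le_n; rewrite Es !size_cat /=; lia.
have mu_s x : x \in mu :: s -> x = b \/ x \in mu :: (s1 ++ c :: s2).
  rewrite Es !(inE, mem_cat) => /or4P[->|->|/eqP->|->]; rewrite ?orbT; by [left|right].
have [[k Abk]|Ab] := pselect (exists k, A b k).
  by exists A; split=> // x /mu_s[->|/asgA //]; exists k.
have aE : last mu s1 \in mu :: (s1 ++ c :: s2).
  by have := mem_last mu s1; rewrite !inE mem_cat => /orP[->|->]; rewrite ?orbT.
have cE : c \in mu :: (s1 ++ c :: s2) by rewrite inE mem_cat mem_head !orbT.
have [i Ai] := asgA _ aE; have [j Aj] := asgA _ cE.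
have inM x : x \in mu :: (s1 ++ c :: s2) -> x \in M.
  by rewrite inE => /orP[/eqP->|/s'M].
have bM : b \in M by apply: sM; rewrite Es mem_cat mem_head orbT.
exists (fun w n => A w n \/ (w = b /\ n = i + j)); split=> [|x /mu_s[->|/asgA[k]]].
- apply: CC_step Ai Aj _ => //; last by move=> k Abk; apply: Ab; exists k.
  have aM := inM _ aE; have cM := inM _ cE.
  split; apply: joinedI => //.
  + by rewrite Dac normr1.
  + by rewrite detC Dbc normrN normr1.
  + by rewrite Dab normr1.
- by exists (i + j); right.
- by exists k; left.
Qed.

Hypothesis joined_unit : forall x y, joined M S x y -> `|D x y| = 1.

Lemma joinedC x y : joined M S x y -> joined M S y x.
Proof. by rewrite /joined [[set x; y]]setUC. Qed.

Lemma joined_lt x y : joined M S x y -> lt x y -> D x y = 1.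
Proof. by move=> /joined_unit E /D_gt0 ?; lia. Qed.

Lemma lt_irr x : ~ lt x x.
Proof. by move=> /D_gt0; rewrite detvv ltxx. Qed.

Lemma D_mu_ge0 x : 0 <= D mu x.
Proof.
have [->|/eqP/mu_min/D_gt0/ltW //] := eqVneq x mu; by rewrite detvv.
Qed.

(** The order in which counting proceeds: nothing beyond the chord {a, c}, as seen
    from mu, is assigned before a and c. *)
Definition separated_assigned (A : vertex -> int -> Prop) :=
  forall y n a c, A y n -> lt mu a -> lt a y -> lt y c -> D a c = 1 ->
  (exists k, A a k) /\ (exists k, A c k).

(** Invariants of counting.  Let z be assigned from the triangle {x, y, z}.  If z
    were not between x and y, one of the other two sides of the triangle would
    separate x or y from mu, so z would have been assigned already.  Hence
    x < z < y and Ptolemy's relation for mu, x, z, y gives the value at z.  A unit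
    chord separating z from mu crosses no side of the triangle: it either is
    {x, y} or separates x or y from mu. *)
Lemma count_sound A :
  CC_stage M S mu A ->
  [/\ forall x n, A x n -> n = D mu x,
      separated_assigned A,
      exists k, A mu k
    & forall x, joined M S mu x -> exists k, A x k].
Proof.
elim=> {A} [|A x y z i j _ [valA sepA asg_mu asg_joined] [Jxy Jyz Jxz] Ax Ay zN].
  split; last by move=> x Jx; exists 1; right.
  - move=> x n [[-> ->]|[Jx ->]]; first by rewrite detvv.
    by have := joined_unit Jx; have := D_mu_ge0 x; lia.
  - move=> y n a c [[-> _]|[Jy _]] mua ay yc Dac.
      by case: (@lt_irr mu); exact: lt_trans ay.
    case: (ones_noncrossing lt_trans D_gt0 mua ay yc _ Dac).
    by apply: joined_lt => //; exact: lt_trans ay.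
  - by exists 0; left.
(* All vertices joined to mu are assigned from the start, so x and y differ
   from mu as well. *)
have zmu : z <> mu by move=> E; case: asg_mu => k; rewrite -E; exact: zN.
have muN w : joined M S w z -> w <> mu.
  by move=> Jwz E; move: Jwz; rewrite E => /asg_joined[k]; exact: zN.
wlog xy : x y i j Jxy Jyz Jxz Ax Ay / lt x y.
  move=> H; have xNy : x <> y.
    by move=> E; have := joined_unit Jxy; rewrite E detvv.
  have [xy|yx] := lt_total xNy; first exact: (H x y i j Jxy Jyz Jxz Ax Ay xy).
  rewrite addrC; exact: (H y x j i (joinedC Jxy) Jxz Jyz).
have mux := mu_min (muN _ Jxz).
have zx : z <> x by move=> E; apply: (zN i); rewrite E.
have zy : z <> y by move=> E; apply: (zN j); rewrite E.
have xz : lt x z.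
  have [zx'|//] := lt_total zx.
  have [|[k Azk] _] := sepA x i z y Ax (mu_min zmu) zx' xy; last by case: (zN k).
  by apply: joined_lt; [exact: joinedC | exact: lt_trans xy].
have zy' : lt z y.
  have [//|yz] := lt_total zy.
  have [|_ [k Azk]] := sepA y j x z Ay mux xy yz; last by case: (zN k).
  exact: joined_lt.
have Dxz := joined_lt Jxz xz; have Dzy := joined_lt (joinedC Jyz) zy'.
have Dxy := joined_lt Jxy xy.
have widen w : (exists k, A w k) -> exists k, A w k \/ (w = z /\ k = i + j).
  by case=> k; exists k; left.
split.
- move=> w n [/valA //|[-> ->]].
  have := ptolemy (W mu) (W x) (W z) (W y).
  by rewrite Dxz Dzy Dxy !mulr1 (valA _ _ Ax) (valA _ _ Ay).
- move=> w n a c Aw mua aw wc Dac.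
  suff [asg_a asg_c] : (exists k, A a k) /\ (exists k, A c k).
    by split; exact: widen.
  case: Aw => [Aw|[Ew _]]; first exact: (sepA w n).
  rewrite {}Ew {w n} in aw wc.
  have [xa|/eqP ax] := eqVneq a x; last first.
    have [ax'|xa] := lt_total ax.
      apply: (sepA x i) => //; exact: lt_trans wc.
    by case: (ones_noncrossing lt_trans D_gt0 xa aw wc Dxz Dac).
  have [yc|/eqP cy] := eqVneq c y; last first.
    have [cy'|yc] := lt_total cy.
      by case: (ones_noncrossing lt_trans D_gt0 aw wc cy' Dac Dzy).
    apply: (sepA y j) => //; exact: lt_trans zy'.
  by rewrite xa yc; split; [exists i|exists j].
- exact: widen.
- by move=> w /asg_joined; exact: widen.
Qed.

End Counting.

(** * The cyclic order on the vertices *)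

Definition vlt (x y : vertex) : bool := point_lt (Vtx x) (Vtx y).

Lemma vlt_same J m n : vlt (J, m) (J, n) = (m < n).
Proof. by rewrite /vlt /point_lt; case: J. Qed.

Lemma vlt_13 m n : vlt (I1, m) (I3, n).
Proof. by []. Qed.

Lemma vlt_31 m n : vlt (I3, m) (I1, n) = false.
Proof. by []. Qed.

Definition vltE := (vlt_same, vlt_13, vlt_31).

Lemma vlt_irr x : vlt x x = false.
Proof. by case: x => J m; rewrite vlt_same ltxx. Qed.

Lemma vlt_trans : transitive vlt.
Proof. by move=> [[] m] [[] n] [[] k]; rewrite !vltE //; lia. Qed.

Lemma vlt_total x y : x <> y -> vlt x y || vlt y x.
Proof.
case: x y => [[] m] [[] n]; rewrite !vltE // => xy.
  by case: (ltgtP m n) xy => // ->.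
by case: (ltgtP m n) xy => // ->.
Qed.

Lemma vlt_asym x y : vlt x y -> vlt y x = false.
Proof.
by move=> xy; apply/negP => /(vlt_trans xy); rewrite vlt_irr.
Qed.

Lemma vlt_succ J m : vlt (J, m) (J, m + 1).
Proof. by rewrite vlt_same; lia. Qed.

Lemma no_vlt_between J m y : vlt (J, m) y -> ~~ vlt y (J, m + 1).
Proof. by case: y => K n; case: J; case: K; rewrite !vltE //; lia. Qed.

(** The circle read anticlockwise starting at mu. *)
Definition cut (mu x y : vertex) : bool :=
  if vlt x mu then vlt y mu && vlt x y else vlt y mu || vlt x y.

Lemma cut_trans mu : transitive (cut mu).
Proof.
move=> y x z; rewrite /cut.
case xm: (vlt x mu); case ym: (vlt y mu); case zm: (vlt z mu) => //=;
  exact: vlt_trans.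
Qed.

Lemma cut_total mu x y : x <> y -> cut mu x y \/ cut mu y x.
Proof.
move/vlt_total=> xy; apply/orP; rewrite /cut.
by case: (vlt x mu); case: (vlt y mu) => //=; rewrite ?orbT.
Qed.

Lemma cut_min mu x : x <> mu -> cut mu mu x.
Proof. by move/vlt_total; rewrite /cut vlt_irr. Qed.

(** Nothing lies between a vertex and its successor, wherever the circle is cut. *)
Lemma no_cut_between mu J m y : cut mu (J, m) y -> ~~ cut mu y (J, m + 1).
Proof.
have succ_mu : vlt (J, m + 1) mu -> vlt (J, m) mu.
  exact: vlt_trans (vlt_succ J m).
rewrite /cut; case pm: (vlt (J, m) mu) succ_mu; case ym: (vlt y mu) => //=.
- by move=> _ py; rewrite (negbTE (no_vlt_between py)) andbF.
- by case: (vlt (J, m + 1) mu) => // /(_ isT).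
- case: (vlt (J, m + 1) mu) => [/(_ isT) //|_ py].
  exact: no_vlt_between py.
Qed.

Lemma cut_succ mu J m : mu <> (J, m + 1) -> ~~ cut mu (J, m + 1) (J, m).
Proof.
move/vlt_total; rewrite /cut; have pq := vlt_succ J m.
rewrite (vlt_asym pq) andbF.
case qm: (vlt (J, m + 1) mu) => //= ; rewrite !orbF => mu_q.
by apply/negP => /no_vlt_between; rewrite mu_q.
Qed.

(** The rotation that makes the string increasing for vlt splits it into the part
    from mu on and the part before mu, which are swapped by reading from mu. *)
Lemma cyclic_lt_path mu s :
  cyclic_lt (map Vtx (mu :: s)) -> path (cut mu) mu s.
Proof.
case=> n; rewrite -map_rot sorted_map => srt.
have {}srt : sorted vlt (rot n (mu :: s)) by exact: srt.
have [s1 [s2 [-> srt']]] : exists s1 s2, s = s1 ++ s2 /\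
    sorted vlt (s2 ++ mu :: s1).
  case: n srt => [|n]; first by rewrite rot0 => srt; exists s, [::]; rewrite cats0.
  by move=> srt; exists (take n s), (drop n s); rewrite cat_take_drop.
suff : sorted (cut mu) (mu :: s1 ++ s2) by [].
move: srt'; rewrite !sorted_pairwise; [|exact: cut_trans|exact: vlt_trans].
rewrite -cat_cons !pairwise_cat => /and3P[all21 pw2 pw1].
have mu_s1 : all (vlt mu) s1 by case/andP: pw1.
have s2_mu x : x \in s2 -> vlt x mu.
  by move/(allrelP all21)=> H; apply: H; exact: mem_head.
have s1_ge x : x \in mu :: s1 -> vlt x mu = false.
  rewrite inE => /orP[/eqP->|/(allP mu_s1)/vlt_asym //]; exact: vlt_irr.
apply/and3P; split.
- by apply/allrelP => x y /s1_ge xm /s2_mu ym; rewrite /cut xm ym.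
- apply: (sub_in_pairwise (P := mem (mu :: s1))) pw1;
    last exact/allP.
  move=> x y /s1_ge xm /s1_ge ym xy.
  by rewrite /cut xm xy orbT.
- apply: (sub_in_pairwise (P := mem s2)) pw2;
    last exact/allP.
  move=> x y /s2_mu xm /s2_mu ym xy.
  by rewrite /cut xm ym.
Qed.

Lemma cyclic_lt_rot n s : cyclic_lt s -> cyclic_lt (rot n s).
Proof.
case=> m srt.
have [k E] : exists k, rot k (rot n s) = rot m s.
  rewrite -{2}(rotK n s) /rotr !(rot_minn m) size_rot.
  set k := (size s - n)%N; have k_le : (k <= size (rot n s))%N by rewrite size_rot leq_subr.
  have m_le : (minn m (size s) <= size (rot n s))%N by rewrite size_rot geq_minr.
  by rewrite size_rot (rot_add_mod k_le m_le); eexists.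
by exists k; rewrite E.
Qed.

Lemma path_cyclic_lt mu a b c :
  cut mu mu a -> cut mu a b -> cut mu b c ->
  cyclic_lt [:: Vtx mu; Vtx a; Vtx b; Vtx c].
Proof.
rewrite /cut vlt_irr => mua ab bc.
pose chain x y z w := [/\ vlt x y, vlt y z & vlt z w].
have close n x y z w : chain x y z w ->
    rot n [:: Vtx mu; Vtx a; Vtx b; Vtx c] = [:: Vtx x; Vtx y; Vtx z; Vtx w] ->
    cyclic_lt [:: Vtx mu; Vtx a; Vtx b; Vtx c].
  move=> [xy yz zw] E; exists n; rewrite E /=.
  by move: xy yz zw; rewrite /vlt => -> -> ->.
move: mua ab bc; case am: (vlt a mu); case bm: (vlt b mu); case cm: (vlt c mu) => //=.
- by move=> *; apply: (@close 1 a b c mu).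
- by move=> *; apply: (@close 2 b c mu a).
- by move=> *; apply: (@close 3 c mu a b).
- by move=> *; apply: (@close 0 mu a b c).
Qed.

Lemma set2_inj (T : Type) (x y a b : T) :
  [set x; y] = [set a; b] -> (x = a /\ y = b) \/ (x = b /\ y = a).
Proof.
move=> E.
have xE : [set a; b] x by rewrite -E; left.
have yE : [set a; b] y by rewrite -E; right.
have aE : [set x; y] a by rewrite E; left.
have bE : [set x; y] b by rewrite E; right.
case: xE yE aE bE => -> [] -> [] H1 [] H2; by [left|right|left; split|right; split].
Qed.

(** * Unit arcs of a positive family of vectors *)

Section PositiveVectors.

Variable V : vertex -> int * int.
Hypothesis V_gt0 : forall x y, vlt x y -> 0 < det (V x) (V y).
Hypothesis V_edge : forall x y, neighbours x y -> `|det (V x) (V y)| = 1.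

(** The analogue of Penner's lambda length of the chord between x and y. *)
Definition lambda x y : int := `|det (V x) (V y)|.

Lemma lambdaC x y : lambda x y = lambda y x.
Proof. by rewrite /lambda detC normrN. Qed.

Lemma lambda_neq x y : lambda x y = 1 -> x <> y.
Proof. by move=> xy E; move: xy; rewrite /lambda E detvv. Qed.

(** Moving the vertices before mu behind the others reverses their order with
    respect to these, which the sign compensates. *)
Definition cut_vector (mu x : vertex) : int * int :=
  if vlt x mu then (- (V x).1, - (V x).2) else V x.

Lemma cut_vectorE mu x y : `|det (cut_vector mu x) (cut_vector mu y)| = lambda x y.
Proof.
rewrite /lambda /cut_vector /det.
case: (vlt x mu); case: (vlt y mu) => //=.
- by rewrite !mulrNN.
- by rewrite -normrN; congr `|_|; ring.
- by rewrite -normrN; congr `|_|; ring.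
Qed.

Lemma cut_vector_gt0 mu x y :
  cut mu x y -> 0 < det (cut_vector mu x) (cut_vector mu y).
Proof.
rewrite /cut /cut_vector; case xm: (vlt x mu); case ym: (vlt y mu) => //=.
- by move/V_gt0; rewrite /det /= !mulrNN.
- move=> _; have xy : x <> y by move=> E; rewrite E ym in xm.
  have [xy'|yx] := orP (vlt_total xy); first by rewrite (vlt_trans xy' ym) in xm.
  by move: (V_gt0 yx); rewrite /det /=; lia.
- exact: V_gt0.
Qed.

Lemma cut_vector1 mu x y : lambda x y = 1 -> cut mu x y ->
  det (cut_vector mu x) (cut_vector mu y) = 1.
Proof. by rewrite -(cut_vectorE mu) => E /cut_vector_gt0; lia. Qed.

Definition unit_arcs : set (set vertex) :=
  [set e | exists x y, [/\ ~ neighbours x y, lambda x y = 1 & e = [set x; y]]].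

Lemma lambda_edge_or_arc x y :
  is_edge [set x; y] \/ unit_arcs [set x; y] -> lambda x y = 1.
Proof.
case=> [[a [b [_ nab E]]]|[a [b [_ ab E]]]].
  by case: (set2_inj E) => -[-> ->]; [|rewrite lambdaC]; exact: V_edge.
by case: (set2_inj E) => -[-> ->] //; rewrite lambdaC.
Qed.

Lemma edge_or_arc_lambda x y :
  lambda x y = 1 -> is_edge [set x; y] \/ unit_arcs [set x; y].
Proof.
move=> xy; have [nxy|nxy] := pselect (neighbours x y).
  by left; exists x, y; split=> //; exact: lambda_neq.
by right; exists x, y.
Qed.

(** This reduces polygons of the disc to unit polygons for a linear order with
    least element mu, to which the counting lemmas apply. *)
Lemma spans_polygon_from M mu :
  spans_polygon unit_arcs M -> mu \in M -> exists s,
  [/\ M =i mu :: s, next M =1 next (mu :: s) &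
      unit_polygon (cut mu) (cut_vector mu) mu s].
Proof.
case=> size_M cycM edgM muM.
have rotE := rot_index muM; set s := (_ ++ _) in rotE.
have pth : path (cut mu) mu s.
  by apply: cyclic_lt_path; rewrite -rotE map_rot; exact: cyclic_lt_rot.
have cut_irr : irreflexive (cut mu).
  by move=> x; rewrite /cut vlt_irr andbF orbF; case: (vlt x mu).
have uniq_s : uniq (mu :: s).
  exact: (sorted_uniq (@cut_trans mu) cut_irr (s := mu :: s) pth).
have uniq_M : uniq M by rewrite -(rot_uniq (index mu M)) rotE.
have nextE : next M =1 next (mu :: s).
  by move=> x; rewrite -rotE next_rot.
exists s; split=> //; first by move=> x; rewrite -(mem_rot (index mu M)) rotE.
have unit_next x : x \in M -> lambda x (next M x) = 1.
  by move=> xM; apply: lambda_edge_or_arc; apply: edgM; exists x.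
have unit_s x : x \in mu :: s -> lambda x (next (mu :: s) x) = 1.
  by move=> xs; rewrite -nextE; apply: unit_next; rewrite -(mem_rot (index mu M)) rotE.
have := cycle_next uniq_s; rewrite /= rcons_path => /andP[pn /eqP last_next].
apply/andP; split; last first.
  have := unit_s _ (mem_last mu s); rewrite last_next lambdaC => lam1.
  apply/eqP/cut_vector1 => //; apply: cut_min.
  by move=> E; apply: (lambda_neq lam1).
have : path (fun x y => cut mu x y && (frel (next (mu :: s)) x y)) mu s.
  by rewrite -[path _ _ _]/(sorted _ (mu :: s)) sorted_relI; apply/andP; split.
apply: sub_in_path (allss (mu :: s)) => x y xs _ /andP[xy /eqP Ey].
rewrite /unit_step xy; apply/eqP/cut_vector1 => //.
by rewrite -Ey; exact: unit_s.
Qed.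

Lemma joined_lambda M x y :
  spans_polygon unit_arcs M ->
  joined M (restricted_triangulation unit_arcs M) x y -> lambda x y = 1.
Proof.
case=> _ _ edgM [/edgM|[[Txy _] _]]; first exact: lambda_edge_or_arc.
by apply: lambda_edge_or_arc; right.
Qed.

(** A polygon containing two neighbours has the edge between them, so that lambda = 1
    always means joined in the polygon. *)
Lemma next_succ M J m :
  spans_polygon unit_arcs M -> (J, m) \in M -> (J, m + 1) \in M ->
  next M (J, m) = (J, m + 1).
Proof.
move=> spM pM qM; have [s [mem_s -> /andP[pth _]]] := spans_polygon_from spM pM.
have qs : (J, m + 1) \in s.
  by move: qM; rewrite mem_s inE => /orP[/eqP[]|//]; lia.
case: s qs pth {mem_s} => // y s qs pth; rewrite /= eqxx.
apply/eqP; rewrite eq_sym; move: qs; rewrite inE => /orP[//|qs].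
have [py yq] : cut (J, m) (J, m) y /\ cut (J, m) y (J, m + 1).
  have : path (cut (J, m)) (J, m) (y :: s) by apply: sub_path pth => a b /andP[].
  rewrite (path_sortedE (@cut_trans _)) /= => /andP[/andP[py _]].
  by rewrite (path_sortedE (@cut_trans _)) => /andP[/allP/(_ _ qs)].
by have := no_cut_between py; rewrite yq.
Qed.

Lemma lambda_joined M x y :
  spans_polygon unit_arcs M -> x \in M -> y \in M -> lambda x y = 1 ->
  joined M (restricted_triangulation unit_arcs M) x y.
Proof.
move=> spM xM yM xy.
have [nxy|nxy] := pselect (neighbours x y); last first.
  have [pxy|pxy] := pselect (polygon_edges M [set x; y]); first by left.
  by right; split=> //; split; [exists x, y|move=> z [] ->].
left; case: x y nxy xM yM {xy} => J m [K n] [/= <- [->|->]] xM yM.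
  by exists (J, m) => //; rewrite next_succ.
by exists (J, n) => //; rewrite next_succ // setUC.
Qed.

(** Being joined in the polygon amounts to lambda = 1 (joined_lambda,
    lambda_joined), which turns count_sound and count_reaches into statements
    about M. *)
Lemma unit_polygon_count M mu nu :
  spans_polygon unit_arcs M -> mu \in M -> nu \in M ->
  polygon_count M (restricted_triangulation unit_arcs M) mu nu (lambda mu nu).
Proof.
move=> spM muM nuM.
have [s [mem_s _ polys]] := spans_polygon_from spM muM.
pose S := restricted_triangulation unit_arcs M.
have joinedE x y : joined M S x y -> `|det (cut_vector mu x) (cut_vector mu y)| = 1.
  by rewrite cut_vectorE; exact: joined_lambda.
have sound A k : CC_stage M S mu A -> A nu k -> k = lambda mu nu.
  move=> stA Ak.
  have [val _ _ _] := count_sound (@cut_trans mu) (@cut_total mu) (@cut_vector_gt0 mu)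
    (@cut_min mu) joinedE stA.
  rewrite (val _ _ Ak) -(cut_vectorE mu) ger0_norm //.
  exact: (D_mu_ge0 (@cut_vector_gt0 mu) (@cut_min mu) nu).
split=> //.
have [A [stA asgA]] : exists A, CC_stage M S mu A /\
    forall x, x \in mu :: s -> exists n, A x n.
  apply: (count_reaches (@cut_trans mu) (@cut_vector_gt0 mu) _ muM _ polys).
    by move=> x y xM yM; rewrite cut_vectorE; exact: lambda_joined.
  by move=> x xs; rewrite mem_s inE xs orbT.
have [n An] := asgA nu (etrans (esym (mem_s nu)) nuM).
by exists A; split=> //; rewrite -(sound A n).
Qed.

(** Two neighbours have no vertex between them on one side, whereas x and mu lie
    on different sides of {a, c}. *)
Lemma separated_not_neighbours mu a x c :
  cut mu mu a -> cut mu a x -> cut mu x c -> ~ neighbours a c.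
Proof.
move=> mua ax xc; have amu : mu <> a.
  by move=> E; move: mua; rewrite E /cut vlt_irr.
have ac := cut_trans ax xc.
case: a c {mua} ax xc amu ac => J m [K n] ax xc amu ac [/= EJ [En|Em]].
  by have := no_cut_between ax; rewrite EJ -En xc.
by move: ac amu; rewrite Em EJ => ac /cut_succ/negP; apply.
Qed.

Lemma unit_arcs_partial : partial_triangulation unit_arcs.
Proof.
split=> [e [x [y [nxy xy ->]]]|e f [x [y [_ xy ->]]] [z [w [_ zw ->]]]].
  by exists x, y; split=> //; exact: lambda_neq.
have no_cross a b c d : lambda a c = 1 -> lambda b d = 1 ->
    ~ cyclic_lt [:: Vtx a; Vtx b; Vtx c; Vtx d].
  move=> ac bd /(@cyclic_lt_path a [:: b; c; d])/= /and4P[ab bc cd _].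
  have ac' := cut_trans ab bc; have bd' := cut_trans bc cd.
  exact: (ones_noncrossing (@cut_trans a) (@cut_vector_gt0 a) ab bc cd
    (cut_vector1 ac ac') (cut_vector1 bd bd')).
case=> [a [c [b [d [Eac Ebd]]]]].
have {}ac : lambda a c = 1 by case: (set2_inj Eac) => -[<- <-] //; rewrite lambdaC.
have {}bd : lambda b d = 1 by case: (set2_inj Ebd) => -[<- <-] //; rewrite lambdaC.
by case; apply: no_cross => //; rewrite lambdaC.
Qed.

(** Maximality: an arc outside unit_arcs lies in some spanned polygon, where it is
    crossed by a unit arc. *)
Lemma triangulation_unit_arcs :
  (forall x y, exists M, [/\ spans_polygon unit_arcs M, x \in M & y \in M]) ->
  triangulation unit_arcs.
Proof.
move=> exM; split; first exact: unit_arcs_partial.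
move=> T [arcT ncT] sT; apply/seteqP; split=> // e Te.
have [mu [nu [nEmu nn Ee]]] := arcT _ Te.
exists mu, nu; split=> //.
have [M [spM muM nuM]] := exM mu nu.
have [s [mem_s _ polys]] := spans_polygon_from spM muM.
have nus : nu \in s by move: nuM; rewrite mem_s inE => /orP[/eqP E|//]; case: nEmu.
have [D1|[a [c [mua anu nuc Dac]]]] :=
  unit_or_crossed (@cut_trans mu) (@cut_vector_gt0 mu) polys nus.
  by rewrite -(cut_vectorE mu) D1.
case: (ncT e [set a; c]) => //.
  apply: sT; exists a, c; split=> //; last by rewrite -(cut_vectorE mu) Dac.
  exact: separated_not_neighbours mua anu nuc.
exists mu, nu, a, c; split=> //; left; exact: path_cyclic_lt.
Qed.

Lemma D2_count_unit_arcs mu nu :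
  (forall x y, exists M, [/\ spans_polygon unit_arcs M, x \in M & y \in M]) ->
  D2_count unit_arcs mu nu (lambda mu nu).
Proof. by move=> exM; split=> // M; exact: unit_polygon_count. Qed.

End PositiveVectors.

(** * Tilings as families of vectors *)

Lemma int_ind_iff (P : int -> Prop) :
  P 0 -> (forall j, P j <-> P (j + 1)) -> forall j, P j.
Proof.
move=> P0 PS; elim/int_rect => // n Pn.
  have -> : n.+1%:Z = n%:Z + 1 by lia.
  exact: ((PS n%:Z).1 Pn).
have E : - n.+1%:Z + 1 = - n%:Z by lia.
by apply: ((PS (- n.+1%:Z)).2 _); rewrite E.
Qed.

(** The ratio x / y is strictly decreasing, since each consecutive minor is 1. *)
Lemma minor_gt0 (x y : int -> int) (u w : int) :
  (forall j, 0 < x j) -> (forall j, 0 < y j) ->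
  (forall j, x j * y (j + 1) - x (j + 1) * y j = 1) ->
  u < w -> 0 < x u * y w - x w * y u.
Proof.
move=> x0 y0 wr uw.
have -> : w = u + 1 + `|(w - u - 1)%R|%N%:Z by lia.
elim: `|_|%N => {uw} [|n IH]; first by rewrite addr0 wr.
have -> : u + 1 + n.+1%:Z = (u + 1 + n%:Z) + 1 by lia.
set v := u + 1 + n%:Z in IH *.
have E : y v * (x u * y (v + 1) - x (v + 1) * y u)
  = y (v + 1) * (x u * y v - x v * y u)
    + y u * (x v * y (v + 1) - x (v + 1) * y v) by ring.
rewrite -(pmulr_rgt0 _ (y0 v)) E wr mulr1.
by apply: ltr_wpDl; rewrite ?mulr_ge0 ?ltW.
Qed.

Definition transposed (t : int -> int -> int) i j : int := t j i.

(** Reflection in the antidiagonal; it preserves the first quadrant and exchanges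
    rows with columns. *)
Definition antitransposed (t : int -> int -> int) i j : int := t (- j) (- i).

Lemma SL2_transposed t : SL2_tiling t -> SL2_tiling (transposed t).
Proof.
case=> t0 tt; split=> i j; first exact: t0.
by rewrite /transposed -[RHS](tt j i); ring.
Qed.

Lemma SL2_antitransposed t : SL2_tiling t -> SL2_tiling (antitransposed t).
Proof.
case=> t0 tt; split=> i j; first exact: t0.
rewrite /antitransposed -[RHS](tt (- j - 1) (- i - 1)) !subrK !opprD; ring.
Qed.

Section Tiling.

Variable t : int -> int -> int.
Hypothesis ht : SL2_tiling t.

Lemma tiling_gt0 i j : 0 < t i j. Proof. by case: ht. Qed.

Lemma tilingE i j : t i j * t (i + 1) (j + 1) - t i (j + 1) * t (i + 1) j = 1.
Proof. by case: ht. Qed.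

Lemma frieze_p_gt0 a d : a < d -> 0 < frieze_p t a d.
Proof.
move=> ad; rewrite /frieze_p [t a 1 * _]mulrC.
apply: (minor_gt0 (x := t^~ 0) (y := t^~ 1)) ad => j; try exact: tiling_gt0.
by have := tilingE j 0; rewrite add0r [t j 1 * _]mulrC.
Qed.

Lemma frieze_q_gt0 u x : u < x -> 0 < frieze_q t u x.
Proof.
apply: (minor_gt0 (x := t 0) (y := t 1)) => j; try exact: tiling_gt0.
by have := tilingE 0 j; rewrite add0r.
Qed.

(** The ratio (t(i-1,j) + t(i+1,j)) / t(i,j) does not depend on j; this is the
    fraction-free form. *)
Lemma row_recurrence i j :
  t i j * (t (i - 1) 0 + t (i + 1) 0) = t i 0 * (t (i - 1) j + t (i + 1) j).
Proof.
elim/int_ind_iff: j => [|j]; first by [].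
have E1 := tilingE i j; have := tilingE (i - 1) j; rewrite subrK => E0.
have := tiling_gt0 i j; have := tiling_gt0 i (j + 1).
set s := _ + t (i + 1) 0 => p1 p0.
have E : t i j * (t (i - 1) (j + 1) + t (i + 1) (j + 1))
  = t i (j + 1) * (t (i - 1) j + t (i + 1) j) by lia.
split=> H.
- apply: (mulfI (lt0r_neq0 p0)).
  rewrite [RHS]mulrCA E [RHS]mulrCA -H; ring.
- apply: (mulfI (lt0r_neq0 p1)).
  by rewrite [RHS]mulrCA -E [RHS]mulrCA -H; ring.
Qed.

(** The difference of the two sides obeys the recurrence of the rows and vanishes
    for i = 0 and i = 1. *)
Lemma tiling_row i j : t i j = frieze_q t 0 j * t i 1 - frieze_q t 1 j * t i 0.
Proof.
pose err k := t k j - (frieze_q t 0 j * t k 1 - frieze_q t 1 j * t k 0).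
suff : err i = 0 /\ err (i + 1) = 0 by case=> /eqP; rewrite subr_eq0 => /eqP.
have err_rec k : t k 0 * (err (k - 1) + err (k + 1))
    = (t (k - 1) 0 + t (k + 1) 0) * err k.
  have Rj := row_recurrence k j; have R1 := row_recurrence k 1.
  have -> : t k 0 * (err (k - 1) + err (k + 1))
      = t k 0 * (t (k - 1) j + t (k + 1) j)
        - frieze_q t 0 j * (t k 0 * (t (k - 1) 1 + t (k + 1) 1))
        + frieze_q t 1 j * (t k 0 * (t (k - 1) 0 + t (k + 1) 0)).
    by rewrite /err; ring.
  by rewrite -Rj -R1 /err; ring.
have base := tilingE 0 0; rewrite !add0r in base.
elim/int_ind_iff: i => [|k].
  have E k : (k = 0 \/ k = 1) ->
      err k = t k j * (1 - (t 0 0 * t 1 1 - t 0 1 * t 1 0)).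
    by case=> ->; rewrite /err /frieze_q; ring.
  by rewrite add0r !E ?base ?subrr ?mulr0 //; [right|left].
have k0 := lt0r_neq0 (tiling_gt0 (k + 1) 0).
split=> -[e1 e2]; split=> //; apply: (mulfI k0); move: (err_rec (k + 1));
  rewrite addrK e1 e2 ?mulr0 ?add0r ?addr0 //.
Qed.

(** Row b of columns 0 and 1 for the vertex b of I; for the vertex v of III the
    vector representing the linear form that maps row b to t b v. *)
Definition tiling_vector (x : vertex) : int * int :=
  match x.1 with
  | I1 => (t x.2 0, t x.2 1)
  | I3 => (- frieze_q t 0 x.2, - frieze_q t 1 x.2)
  end.

Local Notation V := tiling_vector.

Lemma det_I1_I1 a d : det (V (I1, a)) (V (I1, d)) = frieze_p t a d.
Proof. by rewrite /det /frieze_p. Qed.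

Lemma det_I1_I3 b v : det (V (I1, b)) (V (I3, v)) = t b v.
Proof. by rewrite [RHS]tiling_row /det /=; ring. Qed.

Lemma det_I3_I3 u x : det (V (I3, u)) (V (I3, x)) = frieze_q t u x.
Proof.
have base := tilingE 0 0; rewrite !add0r in base.
rewrite -[RHS]mulr1 -base /det /= /frieze_q; ring.
Qed.

Lemma tiling_vector_gt0 x y : vlt x y -> 0 < det (V x) (V y).
Proof.
case: x y => [[] m] [[] n]; rewrite !vltE // => mn.
- by rewrite det_I1_I1 frieze_p_gt0.
- by rewrite det_I1_I3 tiling_gt0.
- by rewrite det_I3_I3 frieze_q_gt0.
Qed.

Lemma tiling_vector_edge x y : neighbours x y -> `|det (V x) (V y)| = 1.
Proof.
have succ J m : det (V (J, m)) (V (J, m + 1)) = 1.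
  case: J; first by rewrite det_I1_I1 /frieze_p -[RHS](tilingE m 0) add0r.
  by rewrite det_I3_I3 /frieze_q -[RHS](tilingE 0 m) add0r.
case: x y => J m [K n] [/= <- [->|->]]; first by rewrite succ.
by rewrite detC succ.
Qed.

Lemma Theta_unit_arcs : Theta t = unit_arcs V.
Proof.
apply/seteqP; split=> e.
- case=> [[[b [v [tbv ->]]]|[a [d [ad p1 ->]]]]|[u [x [ux q1 ->]]]].
  + exists (I1, b), (I3, v); split=> //; first by case.
    by rewrite /lambda det_I1_I3 tbv.
  + exists (I1, a), (I1, d); split=> //; first by case=> _ /= [] ?; lia.
    by rewrite /lambda det_I1_I1 p1.
  + exists (I3, u), (I3, x); split=> //; first by case=> _ /= [] ?; lia.
    by rewrite /lambda det_I3_I3 q1.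
- case=> x [y [nxy xy ->]].
  wlog xy_lt : x y nxy xy / vlt x y.
    move=> H; have [xy'|yx] := orP (vlt_total (lambda_neq xy)); first exact: H.
    rewrite [[set x; y]]setUC; apply: H => //; last by rewrite lambdaC.
    by case=> E D; apply: nxy; split=> //; case: D; [right|left].
  move: xy; rewrite /lambda gtr0_norm ?tiling_vector_gt0 //.
  case: x y nxy xy_lt => [[] m] [[] n] nxy; rewrite !vltE // => mn.
  + rewrite det_I1_I1 => p1; left; right; exists m, n; split=> //.
    by have /eqP : n <> m + 1 by [move=> E; apply: nxy; split=> //; left]; lia.
  + by rewrite det_I1_I3 => t1; left; left; exists m, n.
  + rewrite det_I3_I3 => q1; right; exists m, n; split=> //.
    by have /eqP : n <> m + 1 by [move=> E; apply: nxy; split=> //; left]; lia.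
Qed.

(** * Ones far out in the quadrants *)

(** A positive minor of rows b - 1 and b, evaluated where row b has ones. *)
Lemma row_ones_decreasing b u v :
  u < v -> t b u = 1 -> t b v = 1 -> t (b - 1) v < t (b - 1) u.
Proof.
move=> uv bu bv.
have := @minor_gt0 (t (b - 1)) (t b) u v (tiling_gt0 _) (tiling_gt0 _) _ uv.
rewrite bu bv !mulr1 subr_gt0; apply=> j.
by have := tilingE (b - 1) j; rewrite subrK.
Qed.

(** A strictly decreasing sequence of positive integers is finite. *)
Lemma row_ones_bounded b : exists N, forall v, t b v = 1 -> v <= N.
Proof.
have [[u bu]|no1] := pselect (exists u, t b u = 1); last first.
  by exists 0 => v bv; case: no1; exists v.
have [n] := ubnP `|t (b - 1) u|%N; elim: n u bu => // n IH u bu le_n.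
have [[v [uv bv]]|no_next] := pselect (exists v, u < v /\ t b v = 1).
  apply: (IH v bv); have := row_ones_decreasing uv bu bv.
  by have := tiling_gt0 (b - 1) v; have := tiling_gt0 (b - 1) u; lia.
exists u => v bv; rewrite leNgt; apply/negP => uv.
by apply: no_next; exists v.
Qed.

End Tiling.

Lemma uniform_bound (P : int -> int -> Prop) (lo hi : int) :
  (forall b, exists N, forall v, P b v -> v <= N) ->
  exists N, forall b v, lo <= b <= hi -> P b v -> v <= N.
Proof.
move=> bd; have [n hi_le] : exists n : nat, hi <= lo + n%:Z.
  by exists (absz (hi - lo)); lia.
suff [N HN] : exists N, forall b v, lo <= b <= lo + n%:Z -> P b v -> v <= N.
  by exists N => b v lob; apply: HN; lia.
elim: n {hi_le} => [|n [N IH]].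
  have [N HN] := bd lo; exists N => b v lob.
  have -> : b = lo by lia.
  exact: HN.
have [N' HN'] := bd (lo + n.+1%:Z).
exists (Num.max N N') => b v lob Pbv; rewrite le_max.
have [E|bn] := eqVneq b (lo + n.+1%:Z).
  by rewrite (HN' v) ?orbT // -E.
by rewrite (IH b v) //; lia.
Qed.

Lemma finite_box (m : nat) :
  finite_set [set ij : int * int | (`|ij.1| <= m%:Z) && (`|ij.2| <= m%:Z)].
Proof.
pose r := [seq k%:Z - m%:Z | k <- iota 0 (2 * m + 1)].
have rP (x : int) : `|x| <= m%:Z -> x \in r.
  move=> xm; apply/mapP; exists (absz (x + m%:Z)); last by lia.
  by rewrite mem_iota; lia.
apply: (@sub_finite_set _ _ [set` [seq (x, y) | x <- r, y <- r]]); last exact: finite_seq.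
by move=> [x y] /= /andP[xm ym]; apply: allpairs_f; exact: rP.
Qed.

(** Otherwise every one lies in a finite strip of rows or of columns; each row is
    bounded to the right and each column, by antitransposition, upwards, so that
    the quadrant would contain finitely many ones. *)
Lemma ones_first_unbounded t (N1 N2 : int) :
  SL2_tiling t -> infinite_set (ones_first_quadrant t) ->
  exists b v, [/\ t b v = 1, b < N1 & N2 < v].
Proof.
move=> ht inf; apply: contrapT => none.
have [K HK] := uniform_bound N1 0 (row_ones_bounded ht).
have [L HL] := uniform_bound (- N2) 0 (row_ones_bounded (SL2_antitransposed ht)).
apply: inf; pose m := (`|N1| + `|N2| + `|K| + `|L|)%N.
apply: sub_finite_set (finite_box m) => -[b v] [] /= b0 v0 bv.
have b_or_v : N1 <= b \/ v <= N2.
  have [|bN] := leP N1 b; first by left.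
  by right; rewrite leNgt; apply/negP => Nv; apply: none; exists b, v.
have bK : N1 <= b -> v <= K by move=> Nb; apply: (HK b) => //; lia.
have vL : v <= N2 -> - b <= L.
  move=> vN; apply: (HL (- v)); first by lia.
  by rewrite /antitransposed !opprK.
rewrite /m; lia.
Qed.

Lemma ones_third_unbounded t (N1 N2 : int) :
  SL2_tiling t -> infinite_set (ones_third_quadrant t) ->
  exists b v, [/\ t b v = 1, N1 < b & v < N2].
Proof.
move=> ht inf.
have [] := @ones_first_unbounded (transposed t) N2 N1 (SL2_transposed ht).
  move=> fin; apply: inf.
  pose swap (ij : int * int) := (ij.2, ij.1).
  apply: (@sub_finite_set _ _ (swap @` ones_first_quadrant (transposed t))).
    by move=> [i j] [/= i0 j0 ij]; exists (j, i).
  exact: finite_image.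
by move=> v [b [bv vN bN]]; exists b, v.
Qed.

(** * Blocking and spanning polygons *)

(** Dependent choice, each time beyond the point chosen before. *)
Lemma nested_sequence (P : int -> int -> Prop) :
  (forall N1 N2, exists x y, [/\ P x y, N1 < x & y < N2]) ->
  exists f g : nat -> int,
  [/\ forall i, P (f i) (g i), {homo f : i j / (i < j)%N >-> i < j}
    & {homo g : i j / (i < j)%N >-> j < i}].
Proof.
move=> farP.
have /choice[step stepP] : forall N : int * int, exists p : int * int,
    [/\ P p.1 p.2, N.1 < p.1 & p.2 < N.2].
  by case=> N1 N2; have [x [y H]] := farP N1 N2; exists (x, y).
pose p n := iter n.+1 step (0, 0).
exists (fun n => (p n).1), (fun n => (p n).2); split.
- by move=> n; case: (stepP (iter n step (0, 0))).
- apply: homo_ltn => [y x z|n]; first exact: lt_trans.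
  by case: (stepP (p n)).
- apply: homo_ltn => [y x z yx zy|n]; first exact: lt_trans zy yx.
  by case: (stepP (p n)).
Qed.

Lemma nested_arcs_block T J (f g : nat -> int) :
  (forall i, T [set (J, f i); (next_interval J, g i)]) ->
  {homo f : i j / (i < j)%N >-> i < j} ->
  {homo g : i j / (i < j)%N >-> j < i} ->
  blocks T J.
Proof.
move=> Tfg incr decr.
exists (fun i => (J, f i)), (fun i => (next_interval J, g i)); split=> // n.
rewrite /mkseq -map_rev; set s1 := map _ _; set s2 := map _ _.
have srt1 : pairwise point_lt s1.
  rewrite /s1 pairwise_map; apply: (sub_pairwise (r := ltn)).
    by move=> i j /incr; rewrite -(vlt_same J).
  by rewrite -sorted_pairwise ?iota_ltn_sorted //; exact: ltn_trans.
have srt2 : pairwise point_lt s2.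
  rewrite /s2 pairwise_map; apply: (sub_pairwise (r := fun i j => (j < i)%N)).
    by move=> i j /decr; rewrite -(vlt_same (next_interval J)).
  rewrite -sorted_pairwise; last by move=> y x z yx zy; exact: ltn_trans zy yx.
  by rewrite rev_sorted iota_ltn_sorted.
have allT U (a : pred U) s : (forall x, a x) -> all a s.
  by move=> aT; rewrite (eq_all (a2 := predT)) ?all_predT.
case: J @s1 @s2 srt1 srt2 {Tfg} => s1 s2 srt1 srt2.
- exists 0%N; rewrite rot0; apply: pairwise_sorted.
  rewrite pairwise_cat pairwise_cons srt1 srt2 !andbT; apply/andP; split.
    rewrite /allrel all_map; apply: allT => i /=.
    by rewrite all_map; apply: allT.
  by rewrite all_map; apply: allT.
(* The point Acc I3 is where the circle was cut, so it has to come first. *)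
- exists (size s1); rewrite rot_size_cat cat_cons; apply: pairwise_sorted.
  rewrite pairwise_cons pairwise_cat srt1 srt2 all_cat !andbT.
  rewrite /allrel !all_map; apply/andP; split; first by rewrite !allT.
  by apply: allT => i /=; rewrite all_map; apply: allT.
Qed.

Fixpoint run (J : D2_interval) (m : int) (n : nat) : seq vertex :=
  if n is n'.+1 then (J, m) :: run J (m + 1) n' else [::].

Lemma mem_run J m n k : (J, k) \in run J m n = (m <= k < m + n%:Z).
Proof.
elim: n m => [|n IH] m; first by rewrite in_nil; lia.
rewrite inE IH xpair_eqE eqxx /=; lia.
Qed.

Lemma last_run J m n x : last x (run J m n.+1) = (J, m + n%:Z).
Proof.
elim: n m x => [|n IH] m x; first by rewrite /= addr0.
rewrite -[run _ _ _]/((J, m) :: run J (m + 1) n.+1) last_cons IH.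
by congr (_, _); lia.
Qed.

Lemma path_run (e : rel vertex) J m n :
  (forall k, e (J, k) (J, k + 1)) -> path e (J, m) (run J (m + 1) n).
Proof. by move=> eJ; elim: n m => //= n IH m; rewrite eJ IH. Qed.

(** The polygon b1, ..., b3 in I followed by v3, ..., v1 in III, closed up by the two
    unit arcs. *)
Lemma spans_two_runs V (b1 b3 v1 v3 : int) :
  (forall x y, neighbours x y -> lambda V x y = 1) ->
  b1 < b3 -> v3 < v1 -> lambda V (I1, b1) (I3, v1) = 1 ->
  lambda V (I1, b3) (I3, v3) = 1 ->
  exists M, spans_polygon (unit_arcs V) M /\
    forall x : vertex, (if x.1 is I1 then b1 <= x.2 <= b3 else v3 <= x.2 <= v1) ->
      x \in M.
Proof.
move=> V_edge b13 v31 e1 e3.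
have [n En] : exists n : nat, b3 = b1 + n%:Z by exists (absz (b3 - b1)); lia.
have [m Em] : exists m : nat, v1 = v3 + m%:Z by exists (absz (v1 - v3)); lia.
pose r1 := run I1 (b1 + 1) n; pose r3 := run I3 (v3 + 1) m.
exists ((I1, b1) :: r1 ++ (I3, v3) :: r3); split; last first.
  have in1 b : b1 <= b <= b3 -> (I1, b) \in run I1 b1 n.+1 by rewrite mem_run; lia.
  have in3 v : v3 <= v <= v1 -> (I3, v) \in run I3 v3 m.+1 by rewrite mem_run; lia.
  by case=> [[] k] /= H; rewrite -cat_cons mem_cat ?in1 ?in3 ?orbT.
have last1 : last (I1, b1) r1 = (I1, b3).
  by rewrite En; exact: (last_run I1 b1 n (I1, b1)).
have last3 : last (I3, v3) r3 = (I3, v1).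
  by rewrite Em; exact: (last_run I3 v3 m (I3, v3)).
pose e x y := vlt x y && (lambda V x y == 1).
have e_succ J k : e (J, k) (J, k + 1).
  by rewrite /e vlt_succ V_edge //; split=> //; left.
have pth : path e (I1, b1) (r1 ++ (I3, v3) :: r3).
  by rewrite cat_path last1 /= !path_run // /e e3.
split=> [||E [x xM ->]]; first by rewrite /= size_cat addnS.
  exists 0%N; rewrite rot0 sorted_map.
  have : sorted vlt ((I1, b1) :: r1 ++ (I3, v3) :: r3).
    by apply: sub_path pth => x y /andP[].
  by [].
apply: edge_or_arc_lambda; apply/eqP.
apply: (next_cycle (e := fun x y => lambda V x y == 1)) xM.
rewrite /= rcons_path last_cat /= last3 lambdaC e1 eqxx andbT.
by apply: sub_path pth => x' y /andP[].
Qed.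

Theorem theorem6p1 (t : int -> int -> int)
    (ht : SL2_tiling t)
    (h1 : infinite_set (ones_first_quadrant t))
    (h3 : infinite_set (ones_third_quadrant t)) :
  good_triangulation (Theta t) /\ is_Phi (Theta t) t.
Proof.
have V_gt0 := tiling_vector_gt0 ht; have V_edge := tiling_vector_edge ht.
have exM x y : exists M, [/\ spans_polygon (Theta t) M, x \in M & y \in M].
  case: x y => J k [K l]; pose N : int := `|k| + `|l| + 1.
  have [b1 [v1 [e1 b1N v1N]]] := ones_first_unbounded (- N) N ht h1.
  have [b3 [v3 [e3 b3N v3N]]] := ones_third_unbounded N (- N) ht h3.
  have [||||M [spM inM]] := @spans_two_runs (tiling_vector t) b1 b3 v1 v3 V_edge.
  - by lia.
  - by lia.
  - by rewrite /lambda det_I1_I3 // e1.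
  - by rewrite /lambda det_I1_I3 // e3.
  exists M; rewrite Theta_unit_arcs //; split=> //; apply: inM => /=.
    by case: J; lia.
  by case: K; lia.
rewrite Theta_unit_arcs // in exM *.
split; first split.
- exact: triangulation_unit_arcs.
- case.
    have [f [g [fg incr decr]]] :=
      nested_sequence (fun N1 N2 => ones_third_unbounded N1 N2 ht h3).
    apply: nested_arcs_block incr decr => i.
    by rewrite -Theta_unit_arcs //; left; left; exists (f i), (g i).
  have far N1 N2 : exists v b, [/\ t b v = 1, N1 < v & b < N2].
    by have [b [v [bv bN vN]]] := ones_first_unbounded N2 N1 ht h1; exists v, b.
  have [f [g [fg incr decr]]] := nested_sequence far.
  apply: nested_arcs_block incr decr => i.
  by rewrite -Theta_unit_arcs // setUC; left; left; exists (g i), (f i).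
- move=> b v; have -> : t b v = lambda (tiling_vector t) (I1, b) (I3, v).
    by rewrite /lambda det_I1_I3 // gtr0_norm // tiling_gt0.
  exact: D2_count_unit_arcs.
Qed.
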